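(* Let $L_4=(\partial^2+V(x))^2+U(x)\partial+W(x)$ with $U,V,W\in\mathbf{C}[x]$ be an irreducible operator of order $4$ in $A_1(\mathbf{C})$, and assume $\deg V>\max\{\tfrac12\deg U,\tfrac12\deg W\}$. Then every $M\in A_1(\mathbf{C})$ commuting with $L_4$ has even order.
   Context: $A_1(\mathbf{C})$ is the first Weyl algebra (operators with polynomial coefficients in $x$, $\partial=d/dx$, $[\partial,x]=1$). Irreducible means $L_4$ is not a product of two operators of positive order in $A_1(\mathbf{C})$. The degree of the zero polynomial is $-\infty$. *)

(* Defs.v *)
From HB Require Import structures.
From mathcomp Require Import all_boot all_order all_algebra.
Set Implicit Arguments. Unset Strict Implicit. Unset Printing Implicit Defensive.
Import Order.TTheory GRing.Theory.
Local Open Scope ring_scope.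

(* An element of A_1(F) is represented in normal form
     P = \sum_i a_i(x) \partial^i,   a_i in F[x],
   as a polynomial in \partial (outer variable 'X) with coefficients in F[x]:
   P : {poly {poly F}}, P`_i = a_i.  Addition is polynomial addition; the
   (noncommutative) Weyl product comes from the Leibniz rule
     \partial^i b = \sum_k C(i,k) b^(k) \partial^(i-k).                     *)
Definition weyl_mul (F : fieldType) (P Q : {poly {poly F}}) : {poly {poly F}} :=
  \sum_(i < size P) \sum_(j < size Q) \sum_(k < i.+1)
     (P`_i * ('C(i, k))%:R * (Q`_j)^`(k)) *: 'X^(i - k + j).

Definition weyl_x (F : fieldType) : {poly {poly F}} := ('X : {poly F})%:P.
Definition weyl_d (F : fieldType) : {poly {poly F}} := 'X.

Definition weyl_order (F : fieldType) (P : {poly {poly F}}) : nat := (size P).-1.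

Definition weyl_irreducible (F : fieldType) (L : {poly {poly F}}) : Prop :=
  ~ exists P Q : {poly {poly F}},
      [/\ (0 < weyl_order P)%N, (0 < weyl_order Q)%N & L = weyl_mul P Q].

Definition L4 (F : fieldType) (U V W : {poly F}) : {poly {poly F}} :=
  let D2V := weyl_mul (weyl_d F) (weyl_d F) + V%:P in
  weyl_mul D2V D2V + weyl_mul U%:P (weyl_d F) + W%:P.

(* Main.v *)
Require Import Defs.
From HB Require Import structures.
From mathcomp Require Import all_boot all_order all_algebra.
From mathcomp Require Import zify ring.
Set Implicit Arguments.
Unset Strict Implicit.
Unset Printing Implicit Defensive.
Import Order.TTheory GRing.Theory.
Local Open Scope ring_scope.

(* Give x and the symbol p of \partial positive weights a and b, and let f, g be the
   weighted leading forms of M and L_4, restricted to x = 1. The leading form of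
   [M, L_4] = 0 is a vanishing Poisson bracket, which by Euler's identity becomes
   deg(L_4) g f' = deg(M) f g', i.e. f is a constant times a rational power of g.
   With n = deg V and d = deg U, take (a, b) = (2, n) if 2 d <= 3 n and (3, d)
   otherwise: these are the slopes of the Newton polygon of L_4 at p^4, so
   g = t^4 + (terms of degree <= 2) and g != t^4. Comparing degrees,
   deg f = m is the order of M and 4 g f' = m f g'. If m were odd, a root of g
   would have multiplicity divisible by 4, and g, having no cubic term, would be t^4.
   When n = 0 the hypotheses leave L_4 = (\partial^2 + V)^2, which is reducible. *)

(** * Characteristic zero, induction on monomials, and sizes of polynomials *)

Lemma natr_inj0 (F : fieldType) : [pchar F] =i pred0 ->
  forall m n, (m%:R == n%:R :> F) = (m == n).
Proof.
move=> /pcharf0P charF0 m n; wlog le_mn : m n / (m <= n)%N => [IH|].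
  by case/orP: (leq_total m n) => /IH // E; rewrite eq_sym E eq_sym.
by rewrite eq_sym -subr_eq0 -natrB // charF0 subn_eq0 eqn_leq le_mn.
Qed.

(** Reduces identities that are additive in the operator to monomials c x^i p^j. *)
Lemma bipoly_ind (R : nzRingType) (K : {poly {poly R}} -> Prop) :
  K 0 -> (forall P Q, K P -> K Q -> K (P + Q)) ->
  (forall c i j, K ((c *: 'X^i) *: 'X^j)) -> forall P, K P.
Proof.
move=> K0 KD Km P; rewrite -[P]coefK poly_def.
elim/big_ind: _ => // j _; rewrite -[P`_j]coefK poly_def scaler_suml.
by elim/big_ind: _ => // i _.
Qed.

Lemma map_poly_scaleXn (R S : nzRingType) (f : {additive R -> S}) c j :
  map_poly f (c *: 'X^j) = f c *: 'X^j.
Proof.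
apply/polyP => i; rewrite coef_map !coefZ !coefXn.
by case: eqP; rewrite ?mulr1 ?mulr0 ?raddf0.
Qed.

Lemma leq_size_map_poly (R S : nzRingType) (f : {additive R -> S}) p :
  (size (map_poly f p) <= size p)%N.
Proof. by rewrite map_polyE (leq_trans (size_Poly _)) ?size_map. Qed.

Lemma leq_size_XnM (R : idomainType) n (p q : {poly R}) :
  (size p <= size q)%N -> (size ('X^n * p)%R <= size ('X^n * q)%R)%N.
Proof.
have [-> _|p0 le_pq] := eqVneq p 0; first by rewrite mulr0 size_poly0.
have q0: q != 0 by rewrite -size_poly_gt0 (leq_trans _ le_pq) ?size_poly_gt0.
by rewrite !(mulrC 'X^n) !size_mulXn // leq_add2l.
Qed.

Lemma leq_size_mulX_deriv (R : nzRingType) (p : {poly R}) :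
  (size ('X * p^`())%R <= size p)%N.
Proof.
apply/leq_sizeP => i le_pi; rewrite coefXM coef_deriv.
by case: i le_pi => //= i le_pi; rewrite nth_default ?mul0rn.
Qed.

Lemma coef_mulX_deriv (R : nzRingType) (p : {poly R}) n :
  ('X * p^`())`_n = p`_n *+ n.
Proof. by rewrite coefXM coef_deriv; case: n. Qed.

Lemma coefM_top (R : nzRingType) (p q : {poly R}) m n :
  (size p <= m.+1)%N -> (size q <= n.+1)%N -> (p * q)`_(m + n) = p`_m * q`_n.
Proof.
move=> szp szq; have lt_m : (m < (m + n).+1)%N by lia.
rewrite coefM (bigD1 (Ordinal lt_m)) //= addKn big1 ?addr0 // => i ne_im.
rewrite -val_eqE /= neq_ltn in ne_im; case/orP: ne_im => lt_im.
  by rewrite [X in _ * X]nth_default ?mulr0 //; apply: leq_trans szq _; lia.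
by rewrite nth_default ?mul0r // (leq_trans szp).
Qed.

(** * The Weyl product through divided derivatives, and the weight substitution *)

(** C(i,k) p^(i-k) is the k-th divided derivative of p^i, so the Leibniz rule becomes a sum of
    commutative products of symbols. [N] may exceed [size P], so that initial terms can always be
    split off. *)
Lemma weyl_mulE (F : fieldType) (P Q : {poly {poly F}}) N :
  (size P <= N)%N ->
  weyl_mul P Q = \sum_(k < N) P^`N(k) * map_poly (derivn k) Q.
Proof.
move=> szP; rewrite /weyl_mul.
pose T i j k := (P`_i * ('C(i, k))%:R * (Q`_j)^`(k)) *: 'X^(i - k + j).
(* The range of k becomes independent of i because C(i,k) = 0 for k > i. *)
have extend (i : 'I_(size P)) j :
    \sum_(k < i.+1) T i j k = \sum_(k < N) T i j k.
  rewrite (big_ord_widen _ _ (leq_trans (ltn_ord i) szP)) big_mkcond.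
  apply: eq_bigr => k _; rewrite ltnS; case: leqP => // lt_ik.
  by rewrite /T bin_small // mulr0 mul0r scale0r.
under eq_bigr => i _ do under eq_bigr => j _ do rewrite extend.
under eq_bigr => i _ do rewrite exchange_big /=.
rewrite exchange_big /=; apply: eq_bigr => k _.
rewrite -[X in X^`N(k)]coefK -[X in map_poly _ X]coefK.
rewrite !poly_def !raddf_sum big_distrl /=.
apply: eq_bigr => i _; rewrite big_distrr /=; apply: eq_bigr => j _.
rewrite map_poly_scaleXn /= nderivnZ nderivnXn /T -scaler_nat -!mul_polyC.
rewrite !rmorphM /= exprD !rmorph_nat; ring.
Qed.

(* The substitution x |-> s^a, p |-> t s^b from F[x][p] to F[t][s]: the degree in s
   is the weighted degree, and the leading coefficient in s is the leading form
   at x = 1. *)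
Definition weight_map (F : fieldType) (a b : nat) :
    {poly {poly F}} -> {poly {poly F}} :=
  horner_eval ('X%:P * 'X^b) \o
  map_poly (comp_poly 'X^a \o map_poly (@polyC F)).

HB.instance Definition _ (F : fieldType) (a b : nat) :=
  GRing.RMorphism.copy (@weight_map F a b)
    (horner_eval ('X%:P * 'X^b) \o
     map_poly (comp_poly 'X^a \o map_poly (@polyC F))).

Lemma weight_map_mono (F : fieldType) a b (c : F) i j :
  weight_map a b ((c *: 'X^i) *: 'X^j) = (c *: 'X^j) *: 'X^(a * i + b * j).
Proof.
rewrite /weight_map /= /horner_eval map_poly_scaleXn /= map_poly_scaleXn.
rewrite !comp_polyZ comp_Xn_poly hornerZ hornerXn exprMn -!exprM -!mul_polyC.
rewrite !rmorphM /= rmorphXn exprD /=; ring.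
Qed.

(** Since p = t s^b, the operator s^b d/dp becomes d/dt. *)
Lemma weight_map_nderivn (F : fieldType) a b (P : {poly {poly F}}) k :
  'X^(k * b) * weight_map a b P^`N(k) = map_poly (nderivn k) (weight_map a b P).
Proof.
elim/bipoly_ind: P => [|P Q IHP IHQ|c i j].
- by rewrite !raddf0 mulr0.
- by rewrite !raddfD mulrDr IHP IHQ.
have [lt_jk|le_kj] := ltnP j k.
  rewrite nderivnZ nderivnXn bin_small // scaler0 raddf0 mulr0.
  rewrite weight_map_mono map_poly_scaleXn /= nderivnZ nderivnXn bin_small //.
  by rewrite scaler0 scale0r.
rewrite nderivnZ nderivnXn -scalerMnr raddfMn /= !weight_map_mono.
rewrite map_poly_scaleXn /= nderivnZ nderivnXn -scalerMnr -scalerMnl mulrnAr.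
rewrite -scalerAr -exprD; congr (_ *: 'X^_ *+ _); nia.
Qed.

Lemma mulX_derivXn (R : nzRingType) n : 'X * ('X^n)^`() = 'X^n *+ n :> {poly R}.
Proof.
by rewrite derivXn; case: n => [|n]; rewrite ?mulr0n ?mulr0 // mulrnAr -exprS.
Qed.

(** Euler's identity: on x^i p^j, s d/ds acts as a i + b j and t d/dt as j, so s d/ds - b t d/dt
    acts as a i, that is, as a x d/dx, where x = s^a. *)
Lemma weight_map_euler (F : fieldType) a b (P : {poly {poly F}}) :
  ('X^a * weight_map a b (map_poly deriv P)) *+ a =
  'X * (weight_map a b P)^`() - 'X%:P * map_poly deriv (weight_map a b P) *+ b.
Proof.
elim/bipoly_ind: P => [|P Q IHP IHQ|c i j].
- by rewrite !raddf0 !mulr0 !mul0rn subr0.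
- rewrite !(raddfD, derivD) /= !mulrDr !mulrnDl IHP IHQ opprD; exact: addrACA.
rewrite map_poly_scaleXn /= derivZ derivXn -scalerMnr -scalerMnl raddfMn /=.
rewrite !weight_map_mono map_poly_scaleXn /= !derivZ -scalerAr mulX_derivXn.
rewrite -[(c *: ('X^j)^`()) *: _]mul_polyC mulrA -rmorphM /= -scalerAr mulX_derivXn.
rewrite mul_polyC mulrnAr -scalerAr -exprD -!scalerMnr -scalerMnl -!mulrnA.
case: i => [|i]; first by rewrite mul0n mulr0n muln0 add0n (mulnC j) subrr.
by rewrite addnA -mulnS (mulnC i.+1) (mulnC j) mulrnDr addrK.
Qed.

(** At most one index contributes; the sum keeps the statement additive in [P]. *)
Lemma coef_weight_map (F : fieldType) a b (P : {poly {poly F}}) n j : (0 < a)%N ->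
  (weight_map a b P)`_n`_j = \sum_(i < n.+1 | (a * i + b * j == n)%N) P`_j`_i.
Proof.
move=> a0; elim/bipoly_ind: P => [|P Q IHP IHQ|c i k].
- by rewrite raddf0 !coef0 big1 // => i _; rewrite !coef0.
- rewrite raddfD !coefD IHP IHQ -big_split; apply: eq_bigr => i _.
  by rewrite !coefD.
rewrite weight_map_mono !(coefZ, coefXn).
case: (eqVneq j k) => [->|ne_jk]; last first.
  rewrite big1 => [|l _].
    by case: (n == _); rewrite ?mulr1 ?mulr0 ?coef0 ?coefZ ?coefXn ?(negPf ne_jk) ?mulr0.
  by rewrite mulr0 coef0.
rewrite mulr1.
under eq_bigr => l _ do rewrite coefZ coefXn.
have [->|ne_n] := eqVneq n (a * i + b * k)%N; last first.
  rewrite mulr0 coef0 big1 // => l /eqP def_n; case: eqP => [E|]; last by rewrite mulr0.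
  by rewrite -E def_n eqxx in ne_n.
rewrite mulr1 coefZ coefXn eqxx.
have lt_i : (i < (a * i + b * k).+1)%N by nia.
rewrite (bigD1 (Ordinal lt_i)) //= eqxx big1 ?addr0 // => l /andP[_ ne_l].
by rewrite -val_eqE /= in ne_l; rewrite (negPf ne_l) mulr0.
Qed.

(** Here [map_poly deriv] is d/dt and the outer derivative is d/ds. The terms with two t-derivatives
    are symmetric and cancel; on a top coefficient, s d/ds is multiplication by the degree. *)
Lemma coef_bracket (R : comNzRingType) (N K : {poly {poly R}}) c :
  let n := ((size N).-1 + (size K).-1)%N in
  (map_poly deriv N * ('X * K^`() - 'X%:P * map_poly deriv K *+ c))`_n =
  (map_poly deriv K * ('X * N^`() - 'X%:P * map_poly deriv N *+ c))`_n ->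
  (lead_coef N)^`() * (lead_coef K *+ (size K).-1) =
  (lead_coef K)^`() * (lead_coef N *+ (size N).-1).
Proof.
have szd (Q : {poly {poly R}}) : (size (map_poly deriv Q) <= (size Q).-1.+1)%N.
  by rewrite (leq_trans (leq_size_map_poly _ _)) // leqSpred.
have szX (Q : {poly {poly R}}) : (size ('X * Q^`())%R <= (size Q).-1.+1)%N.
  by rewrite (leq_trans (leq_size_mulX_deriv _)) // leqSpred.
move=> /=; rewrite 2!mulrBr 2!coefB.
have -> : map_poly deriv N * ('X%:P * map_poly deriv K *+ c) =
   map_poly deriv K * ('X%:P * map_poly deriv N *+ c).
  rewrite 2!mulrnAr; congr (_ *+ _); rewrite mulrCA; apply: etrans (mulrCA _ _ _).
  by congr (_ * _); rewrite mulrC.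
move/addIr; rewrite (coefM_top (szd _) (szX _)).
rewrite addnC (coefM_top (szd _) (szX _)) !coef_map !coef_mulX_deriv.
exact.
Qed.

(** * Leading forms of a vanishing commutator *)

Section Commutator.
Variables (F : fieldType) (a b : nat).
Hypotheses (charF0 : [pchar F] =i pred0) (a_gt0 : (0 < a)%N) (b_gt0 : (0 < b)%N).
Implicit Types L M P Q : {poly {poly F}}.
Local Notation Phi := (@weight_map F a b).

Lemma size_weight_map_dp P k :
  (size ('X^(k * b) * Phi P^`N(k))%R <= size (Phi P))%N.
Proof. by rewrite weight_map_nderivn leq_size_map_poly. Qed.

(** Euler's identity expresses each x-derivative through s d/ds and t d/dt, which do not raise the
    degree in s; the factor a is invertible in characteristic zero. *)
Lemma size_weight_map_dx P k :
  (size ('X^(k * a) * Phi (map_poly (derivn k) P))%R <= size (Phi P))%N.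
Proof.
elim: k => [|k IHk].
  by rewrite mul0n mul1r map_poly_id.
have -> : map_poly (derivn k.+1) P = map_poly deriv (map_poly (derivn k) P).
  by apply/polyP => i; rewrite !coef_map /=.
set Q := map_poly (derivn k) P in IHk *.
rewrite mulSn addnC exprD -mulrA; apply: leq_trans IHk; apply: leq_size_XnM.
set q := 'X^a * _.
have a0 : (a%:R : {poly F}) != 0.
  by rewrite -polyC_natr polyC_eq0 (natr_inj0 charF0 a 0) -lt0n.
have -> : size q = size (q *+ a) by rewrite -scaler_nat size_scale.
rewrite weight_map_euler (leq_trans (size_polyD _ _)) // geq_max.
rewrite leq_size_mulX_deriv size_polyN -mulrnAl -rmorphMn mul_polyC /=.
by rewrite (leq_trans (size_scale_leq _ _)) // leq_size_map_poly.
Qed.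

(** The k-th term loses weight at least k(a + b), so a shift by a + b alone leaves it below the top
    degree. *)
Lemma coef_weight_map_tail P Q k : (1 < k)%N ->
  ('X^(a + b) * Phi (P^`N(k) * map_poly (derivn k) Q))
    `_((size (Phi P)).-1 + (size (Phi Q)).-1) = 0.
Proof.
move=> k_gt1; set u := Phi (_ * _); set n := (_.-1 + _)%N.
(* A further shift by (k - 1)(a + b) gives each derivative the power of s that compensates its loss
   of weight. *)
have -> : ('X^(a + b) * u)`_n = ('X^(k * b + k * a) * u)`_(n + k.-1 * (a + b)).
  rewrite !coefXnM.
  have -> : (n + k.-1 * (a + b) < k * b + k * a)%N = (n < a + b)%N by nia.
  by case: ifP => // _; congr (_`_ _); nia.
rewrite /u rmorphM /= exprD mulrACA nth_default //.
apply: leq_trans (size_polyMleq _ _) _.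
have := size_weight_map_dp P k; have := size_weight_map_dx Q k.
rewrite /n; set x := size _; set y := size _; set z := size _; set w := size _.
by move=> *; nia.
Qed.

Lemma weight_map_first_order P Q :
  ('X^(a + b) * Phi (P^`() * map_poly deriv Q)) *+ a =
  map_poly deriv (Phi P) *
    ('X * (Phi Q)^`() - 'X%:P * map_poly deriv (Phi Q) *+ b).
Proof.
rewrite -weight_map_euler rmorphM /= addnC exprD mulrACA -nderivn1.
have := weight_map_nderivn a b P 1; rewrite mul1n => ->.
by rewrite (eq_map_poly (@nderivn1 F)) mulrnAr.
Qed.

(** [P * Q] is split off because it cancels in the commutator; of the rest only the first-order term
    reaches degree n. Both orders of the factors can share the same [n]. *)
Lemma weyl_mul_expand P Q n : n = ((size (Phi P)).-1 + (size (Phi Q)).-1)%N ->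
  exists2 T, weyl_mul P Q = P * Q + T &
    ('X^(a + b) * Phi T)`_n *+ a =
    (map_poly deriv (Phi P) *
      ('X * (Phi Q)^`() - 'X%:P * map_poly deriv (Phi Q) *+ b))`_n.
Proof.
move=> def_n.
exists (P^`() * map_poly deriv Q +
        \sum_(k < size P) P^`N(k.+2) * map_poly (derivn k.+2) Q).
  rewrite (@weyl_mulE F P Q (size P).+2); last by rewrite !leqW.
  by rewrite 2!big_ord_recl /= nderivn0 nderivn1 (map_poly_id (fun _ _ => erefl)).
rewrite -weight_map_first_order coefMn raddfD mulrDr coefD raddf_sum big_distrr.
rewrite [X in _ + X]coef_sum big1 ?addr0 // => k _.
by rewrite def_n coef_weight_map_tail.
Qed.

Lemma symbol_relation L M : weyl_mul M L = weyl_mul L M ->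
  (lead_coef (Phi M))^`() * (lead_coef (Phi L) *+ (size (Phi L)).-1) =
  (lead_coef (Phi L))^`() * (lead_coef (Phi M) *+ (size (Phi M)).-1).
Proof.
have [T -> defT] := weyl_mul_expand (erefl ((size (Phi M)).-1 + (size (Phi L)).-1)%N).
have [T' -> defT'] := weyl_mul_expand (addnC (size (Phi M)).-1 (size (Phi L)).-1).
(* Commutation makes the two remainders equal, hence also their coefficients of s^n. *)
rewrite [L * M]mulrC => /addrI eqT; subst T'.
exact: coef_bracket (etrans (esym defT) defT').
Qed.
End Commutator.

(** * Degrees and root multiplicities when B f' g = A f g' *)

(** After multiplication by t, compare the coefficients of t^(deg f + deg g). *)
Lemma proportional_degree (F : fieldType) (f g : {poly F}) A B :
  [pchar F] =i pred0 -> f != 0 -> g != 0 ->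
  f^`() * (g *+ B) = g^`() * (f *+ A) ->
  ((size f).-1 * B = (size g).-1 * A)%N.
Proof.
move=> charF0 f0 g0 /(congr1 (fun p => ('X * p)`_((size f).-1 + (size g).-1))).
rewrite 2!mulrA coefM_top; last 2 first.
- by rewrite (leq_trans (leq_size_mulX_deriv _)) // leqSpred.
- by rewrite -scaler_nat (leq_trans (size_scale_leq _ _)) // leqSpred.
rewrite addnC coefM_top; last 2 first.
- by rewrite (leq_trans (leq_size_mulX_deriv _)) // leqSpred.
- by rewrite -scaler_nat (leq_trans (size_scale_leq _ _)) // leqSpred.
rewrite !coef_mulX_deriv !coefMn -!/(lead_coef _) !mulrnAl !mulrnAr -!mulrnA.
rewrite (mulrC (lead_coef g)) -!(mulr_natr (lead_coef f * _)).
move/mulfI; rewrite mulf_neq0 ?lead_coef_eq0 // => /(_ isT).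
move/eqP; rewrite (natr_inj0 charF0) => /eqP.
by rewrite mulnC => ->; rewrite mulnC.
Qed.

(** The extra factor z avoids the exponent n - 1, so n = 0 is covered too. *)
Lemma mul_deriv_mul_exp (R : comNzRingType) (z p : {poly R}) n :
  z^`() = 1 -> z * (p * z ^+ n)^`() = (z * p^`() + p *+ n) * z ^+ n.
Proof.
move=> dz; rewrite derivM deriv_exp dz mul1r; case: n => [|n] /=.
  by rewrite !mulr0n mulr0 !addr0 mulrA.
by rewrite mulrDl mulrDr mulrA !mulrnAr mulrnAl mulrCA -exprS.
Qed.

(** Compares the residues at r of B f'/f and A g'/g without fractions: multiply by z = t - r, cancel
    z^(k+e), evaluate at r. *)
Lemma proportional_multiplicity (F : fieldType) (q h : {poly F}) r k e A B :
  [pchar F] =i pred0 -> ~~ root q r -> ~~ root h r ->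
  let f := q * ('X - r%:P) ^+ k in let g := h * ('X - r%:P) ^+ e in
  f^`() * (g *+ B) = g^`() * (f *+ A) -> (k * B = e * A)%N.
Proof.
move=> charF0 qr hr f g.
set z := 'X - r%:P in f g *.
have zd (p : {poly F}) n := mul_deriv_mul_exp p n (derivXsubC r).
rewrite -/z in zd.
have z0 n : z ^+ n != 0 by rewrite expf_neq0 // polyXsubC_eq0.
move/(congr1 (fun p => z * p)); rewrite 2!mulrA /f /g -/z !zd.
have -> : (z * q^`() + q *+ k) * z ^+ k * (h * z ^+ e *+ B) =
  z ^+ (k + e) * ((z * q^`() + q *+ k) * (h *+ B)).
  by rewrite exprD -mulrnAl mulrACA mulrC.
have -> : (z * h^`() + h *+ e) * z ^+ e * (q * z ^+ k *+ A) =
  z ^+ (k + e) * ((z * h^`() + h *+ e) * (q *+ A)).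
  by rewrite addnC exprD -mulrnAl mulrACA mulrC.
move/(mulfI (z0 _))/(congr1 (fun p => p.[r])).
rewrite !hornerE !hornerMn subrr !mul0r !add0r !mulrnAl !mulrnAr -!mulrnA.
rewrite (mulrC h.[r]) -!(mulr_natr (q.[r] * _)).
move/mulfI; rewrite mulf_neq0 // => /(_ isT).
move/eqP; rewrite (natr_inj0 charF0) => /eqP.
by rewrite mulnC => ->; rewrite mulnC.
Qed.

Lemma depressed_quartic_even (F : closedFieldType) (f g : {poly F}) b m :
  [pchar F] =i pred0 -> (0 < b)%N -> f != 0 -> g \is monic -> size g = 5 -> g`_3 = 0 ->
  g != 'X^4 -> f^`() * (g *+ (b * 4)) = g^`() * (f *+ (b * m)) -> ~~ odd m.
Proof.
move=> charF0 b_gt0 f0 g_monic szg g3 neq_g rel; apply/negP => odd_m.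
have g0 : g != 0 by rewrite monic_neq0.
have [|r gr] := @closed_rootP F g _; first by rewrite szg.
(* [k] may be 0: r is not known to be a root of [f]. *)
have [k [q]] := multiplicity_XsubC f r; rewrite f0 /= => qr def_f.
have [e [h]] := multiplicity_XsubC g r; rewrite g0 /= => hr def_g.
have h0 : h != 0 by apply: contraNneq hr => ->; rewrite root0.
have e_gt0 : (0 < e)%N.
  by rewrite lt0n; apply: contraL gr => /eqP e0; rewrite def_g e0 mulr1.
have szh : (size h + e)%N = 5.
  by rewrite -szg def_g size_mul ?expf_neq0 ?polyXsubC_eq0 // size_exp_XsubC addnS.
have h_gt0 : (0 < size h)%N by rewrite size_poly_gt0.
have mult : (k * 4 = e * m)%N.
  apply/eqP; rewrite -(eqn_pmul2l b_gt0) mulnCA (mulnCA b e); apply/eqP.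
  by apply: (proportional_multiplicity charF0 qr hr); rewrite -def_f -def_g.
(* As m is odd, 4 divides e, and 0 < e <= 4 by [szh]. *)
have e4 : e = 4%N.
  have : (4 %| e * m)%N by rewrite -mult dvdn_mull.
  rewrite Gauss_dvdl; last by rewrite (coprime_pexpl 2 m (ltn0Sn 1)) coprime2n.
  by move/dvdn_leq; lia.
have [c c0 def_h] : exists2 c, c != 0 & h = c%:P by apply/size_poly1P/eqP; lia.
have c1 : c = 1.
  move/monicP: g_monic; rewrite def_g def_h lead_coefM lead_coefC.
  by rewrite (monicP (monic_exp _ (monicXsubC r))) mulr1.
have def_g4 : g = ('X - r%:P) ^+ 4 by rewrite def_g def_h c1 mul1r e4.
(* The cubic coefficient of (t - r)^4 is -4r. *)
have r0 : r = 0.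
  apply/eqP; move: g3; rewrite def_g4.
  have -> : ('X - r%:P) ^+ 4 =
      'X^4 - (r *+ 4) *: 'X^3 + (r ^+ 2 *+ 6) *: 'X^2 -
      (r ^+ 3 *+ 4) *: 'X + (r ^+ 4)%:P.
    rewrite -!mul_polyC !rmorphMn !rmorphXn /=; ring.
  rewrite !(coefD, coefN, coefZ, coefXn, coefX, coefC) /=.
  rewrite !mulr0 mulr1 subr0 !addr0 add0r => /eqP.
  by rewrite oppr_eq0 -mulr_natr mulf_eq0 (natr_inj0 charF0 4 0) orbF.
by rewrite def_g4 r0 subr0 eqxx in neq_g.
Qed.

(** * From the support of an operator to the parity of the order *)

Lemma coef_weight_map_diag (F : fieldType) a b (P : {poly {poly F}}) i j :
  (0 < a)%N -> (weight_map a b P)`_(a * i + b * j)`_j = P`_j`_i.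
Proof.
move=> a_gt0; rewrite coef_weight_map //.
have lt_i : (i < (a * i + b * j).+1)%N by nia.
rewrite (big_pred1 (Ordinal lt_i)) // => l.
by rewrite eqn_add2r eqn_pmul2l // -val_eqE.
Qed.

Lemma coef_weight_map_neq0 (F : fieldType) a b (P : {poly {poly F}}) n j :
  (0 < a)%N -> (weight_map a b P)`_n`_j != 0 ->
  exists2 i, n = (a * i + b * j)%N & P`_j`_i != 0.
Proof.
move=> a_gt0; rewrite coef_weight_map //.
have [/existsP[i /andP[/eqP wt Pi]] _|/existsPn noi] :=
  boolP [exists i : 'I_n.+1, ((a * i + b * j)%N == n) && (P`_j`_i != 0)].
  by exists (val i).
rewrite big1 ?eqxx // => i ai; apply/eqP.
by have := noi i; rewrite ai negbK.
Qed.

(** The support condition makes 4b the top weight of [L], attained at p^4; the second point x^i0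
    p^j0 of that weight keeps the leading form different from t^4. *)
Lemma even_order_of_symbol (F : closedFieldType) (L M : {poly {poly F}}) a b i0 j0 :
  [pchar F] =i pred0 -> (0 < a)%N -> (0 < b)%N ->
  (forall i j, L`_j`_i != 0 -> (a * i + b * j <= b * 4)%N) ->
  L`_4`_0 = 1 -> L`_3 = 0 ->
  (j0 < 4)%N -> (a * i0 + b * j0 = b * 4)%N -> L`_j0`_i0 != 0 ->
  M != 0 -> weyl_mul M L = weyl_mul L M -> ~~ odd (weyl_order M).
Proof.
move=> charF0 a_gt0 b_gt0 suppL L4 L3 j0_lt4 wt0 L0 M0.
move/(symbol_relation charF0 a_gt0 b_gt0).
set N := weight_map a b M; set K := weight_map a b L.
have szK : size K = (b * 4).+1.
  apply/eqP; rewrite eqn_leq; apply/andP; split.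
    apply/leq_sizeP => n lt_n; apply/polyP => j; rewrite coef0; apply/eqP.
    apply: contraTT lt_n => /(coef_weight_map_neq0 a_gt0)[i -> /suppL].
    by rewrite -leqNgt.
  rewrite ltnNge; apply/negP => /leq_sizeP/(_ _ (leqnn _))/polyP/(_ 4%N).
  have := coef_weight_map_diag b L 0 4 a_gt0; rewrite muln0 add0n -/K => -> /eqP.
  by rewrite L4 coef0 oner_eq0.
(* Distinct monomials have distinct images, so none is lost by cancellation. *)
have suppN i j : M`_j`_i != 0 -> (a * i + b * j <= (size N).-1)%N.
  move=> Mji; rewrite -ltnS; apply: leq_trans (leqSpred _); rewrite ltnNge.
  apply: contra Mji => /leq_sizeP/(_ _ (leqnn _))/polyP/(_ j).
  by rewrite coef_weight_map_diag // coef0 => ->.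
have [m [i Mmi] def_m] : exists2 m, (exists i, M`_m`_i != 0) & weyl_order M = m.
  by exists (weyl_order M) => //; exists (size (lead_coef M)).-1; rewrite !lead_coef_eq0.
have N0 : N != 0.
  apply: contraNneq Mmi => N0; rewrite -(coef_weight_map_diag b M i m a_gt0).
  by rewrite -/N N0 !coef0.
set f := lead_coef N; set g := lead_coef K; rewrite szK /= => rel.
have f0 : f != 0 by rewrite lead_coef_eq0.
have gE j : g`_j = K`_(b * 4)`_j by rewrite /g lead_coefE szK.
have g4 : g`_4 = 1.
  by rewrite gE -L4 -(coef_weight_map_diag b L 0 4 a_gt0) muln0.
have g3 : g`_3 = 0.
  apply/eqP; rewrite gE; apply: contraT => /(coef_weight_map_neq0 a_gt0)[l _].
  by rewrite L3 coef0 eqxx.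
have szg : size g = 5.
  apply/eqP; rewrite eqn_leq; apply/andP; split; last first.
    rewrite ltnNge; apply/negP => /leq_sizeP/(_ _ (leqnn _)) /eqP.
    by rewrite g4 oner_eq0.
  apply/leq_sizeP => j lt4j; apply/eqP; rewrite gE; apply: contraT.
  by move=> /(coef_weight_map_neq0 a_gt0)[l wt _]; nia.
have g_monic : g \is monic by rewrite monicE lead_coefE szg g4.
have neq_g : g != 'X^4.
  apply: contraNneq L0 => def_g; rewrite -(coef_weight_map_diag b L i0 j0 a_gt0).
  by rewrite wt0 -/K -gE def_g coefXn (ltn_eqF j0_lt4).
have wtN : (size N).-1 = (b * (size f).-1)%N.
  have := proportional_degree charF0 f0 (monic_neq0 g_monic) rel.
  by rewrite szg /=; lia.
(* The coefficients of [f] come from those of [M], so deg f <= m. Conversely x^i p^m has weight at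
   least b m and at most b deg f. *)
have def_f : (size f).-1 = m.
  apply/eqP; rewrite eqn_leq; apply/andP; split.
    have : N`_(size N).-1`_(size f).-1 != 0 by rewrite lead_coef_eq0.
    case/(coef_weight_map_neq0 a_gt0) => l _ Ml.
    rewrite -def_m /weyl_order -ltnS; apply: leq_trans (leqSpred _).
    rewrite ltnNge; apply: contra Ml => /leq_sizeP/(_ _ (leqnn _)) ->.
    by rewrite coef0.
  have := suppN _ _ Mmi; rewrite wtN => le_m.
  by rewrite -(leq_pmul2l b_gt0) (leq_trans (leq_addl _ _) le_m).
rewrite def_m; apply: depressed_quartic_even charF0 b_gt0 f0 g_monic szg g3 neq_g _.
by rewrite rel wtN def_f.
Qed.

(** * Normal form and support of [L4] *)

Lemma map_derivn_Xn (F : fieldType) k n :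
  map_poly (derivn k.+1) ('X^n : {poly {poly F}}) = 0.
Proof.
rewrite -['X^n]scale1r map_poly_scaleXn -[X in X *: _]/(derivn k.+1 1%:P).
by rewrite derivnC scale0r.
Qed.

Lemma map_derivn0 (F : fieldType) (P : {poly {poly F}}) :
  map_poly (derivn 0) P = P.
Proof. exact: map_poly_id. Qed.

Lemma weyl_mul_dd (F : fieldType) : weyl_mul (weyl_d F) (weyl_d F) = 'X^2.
Proof.
rewrite (@weyl_mulE F _ _ 2) ?size_polyX // !big_ord_recl big_ord0 /=.
by rewrite nderivn0 map_derivn0 (map_derivn_Xn F 0 1) mulr0 !addr0.
Qed.

(** The derivatives of V come from \partial^2 V = V \partial^2 + 2 V' \partial + V''. *)
Lemma L4E (F : fieldType) (U V W : {poly F}) :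
  L4 U V W = 'X^4 + (V *+ 2) *: 'X^2 + (V^`() *+ 2 + U) *: 'X +
             (V ^+ 2 + V^`()^`() + W)%:P.
Proof.
have dVC k : map_poly (derivn k.+1) ('X^2 + V%:P) = (V^`(k.+1))%:P.
  rewrite (raddfD (map_poly (derivn k.+1))) [X in X + _](map_derivn_Xn F k 2) add0r.
  exact: map_polyC.
have UD : weyl_mul U%:P (weyl_d F) = U *: 'X.
  rewrite (@weyl_mulE F _ _ 1) ?size_polyC_leq1 // big_ord1 nderivn0 map_derivn0.
  by rewrite mul_polyC.
rewrite /L4 weyl_mul_dd UD (@weyl_mulE F _ _ 3); last first.
  rewrite (leq_trans (size_polyD _ _)) // size_polyXn geq_max /=.
  by rewrite (leq_trans (size_polyC_leq1 _)).
rewrite !big_ord_recl big_ord0 /= nderivn0 nderivn1 map_derivn0 !dVC.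
rewrite nderivnD nderivnXn nderivnC /= derivD derivXn derivC expr0 expr1 !addr0.
rewrite (_ : bump _ _ = 2%N) // binn.
rewrite -!mul_polyC !(rmorphD, rmorphMn, rmorphXn) /=; ring.
Qed.

Lemma coef_L4 (F : fieldType) (U V W : {poly F}) j :
  (L4 U V W)`_j = [:: V ^+ 2 + V^`()^`() + W; V^`() *+ 2 + U; V *+ 2; 0; 1]`_j.
Proof.
rewrite L4E !(coefD, coefZ, coefXn, coefX, coefC).
case: j => [|[|[|[|[|j]]]]] /=; rewrite ?(mulr0, mulr1, addr0, add0r) //.
by rewrite nth_nil.
Qed.

(** For j = 1 the strict bound merges deg V' < n with deg U <= d. *)
Lemma L4_support (F : fieldType) (U V W : {poly F}) d n i j :
  (size U <= d.+1)%N -> size V = n.+1 -> (size W <= n * 2)%N -> (L4 U V W)`_j`_i != 0 ->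
  [\/ (j = 4 /\ i = 0)%N, (j = 2 /\ i <= n)%N,
      (j = 1 /\ i < maxn n d.+1)%N | (j = 0 /\ i <= n * 2)%N].
Proof.
move=> szU szV szW; rewrite coef_L4; case: j => [|[|[|[|[|j]]]]] /= nz.
- constructor 4; split => //; move: nz; apply: contraR; rewrite -ltnNge => lt_i.
  rewrite !coefD [X in X + _ + _]nth_default; last first.
    by rewrite (leq_trans (size_poly_exp_leq _ _)) // szV /=; lia.
  rewrite !coef_deriv [W`_i]nth_default ?(leq_trans szW (ltnW lt_i)) //.
  by rewrite nth_default ?mul0rn ?addr0 // szV; lia.
- constructor 3; split => //; move: nz; apply: contraR; rewrite -leqNgt geq_max.
  case/andP => le_n le_U; rewrite coefD coefMn coef_deriv.
  by rewrite [U`_i]nth_default ?(leq_trans szU) // nth_default ?mul0rn ?addr0 // szV.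
- constructor 2; split => //; move: nz; apply: contraR; rewrite -ltnNge => lt_i.
  by rewrite coefMn nth_default ?mul0rn // szV.
- by rewrite coef0 eqxx in nz.
- constructor 1; split => //; move: nz; rewrite coef1.
  by case: i => // i; rewrite eqxx.
- by rewrite nth_nil coef0 eqxx in nz.
Qed.

Lemma L4_square_reducible (F : fieldType) (V : {poly F}) :
  ~ weyl_irreducible (L4 0 V 0).
Proof.
have D_gt0 : (0 < weyl_order (weyl_mul (weyl_d F) (weyl_d F) + V%:P))%N.
  rewrite weyl_mul_dd /weyl_order size_polyDl size_polyXn //.
  by rewrite ltnS (leq_trans (size_polyC_leq1 _)).
apply; exists (weyl_mul (weyl_d F) (weyl_d F) + V%:P).
exists (weyl_mul (weyl_d F) (weyl_d F) + V%:P); split=> //.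
rewrite /L4 (_ : weyl_mul 0%:P _ = 0) ?addr0 //.
by rewrite /weyl_mul polyC0 size_poly0 big_ord0.
Qed.

Theorem mainTheorem7 (F : closedFieldType) (charF0 : [pchar F] =i pred0)
    (U V W : {poly F}) :
  weyl_order (L4 U V W) = 4%N ->
  weyl_irreducible (L4 U V W) ->
  (* deg V > max (deg U / 2, deg W / 2), with deg 0 = -oo *)
  V != 0 ->
  (U != 0 -> ((size U).-1 < 2 * (size V).-1)%N) ->
  (W != 0 -> ((size W).-1 < 2 * (size V).-1)%N) ->
  forall M : {poly {poly F}}, M != 0 ->
    weyl_mul M (L4 U V W) = weyl_mul (L4 U V W) M ->
    ~~ odd (weyl_order M).
Proof.
move=> _ irrL V0 degU degW M M0 comm.
have [n szV] : exists n, size V = n.+1.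
  by exists (size V).-1; rewrite prednK // size_poly_gt0.
rewrite szV /= in degU degW.
have two0 : 2%:R != 0 :> F by rewrite (natr_inj0 charF0 2 0).
have [n0|n_gt0] := posnP n.
  (* A nonzero U or W would have degree below 0. *)
  have U0 : U = 0 by apply/eqP; apply: contraT => /degU; rewrite n0.
  have W0 : W = 0 by apply/eqP; apply: contraT => /degW; rewrite n0.
  by case: (@L4_square_reducible F V); rewrite -{1}U0 -W0.
have szW : (size W <= n * 2)%N.
  have [->|/degW ltW] := eqVneq W 0; first by rewrite size_poly0.
  by rewrite mulnC (leq_trans (leqSpred _)).
(* U = 0 gives d = 0, which falls under the first choice of weights. *)
have [d def_d] : exists d, (size U).-1 = d by exists (size U).-1.
have szU : (size U <= d.+1)%N by rewrite -def_d leqSpred.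
have supp i j := @L4_support F U V W d n i j szU szV szW.
have [small|large] := leqP (2 * d) (3 * n).
  (* The top weight is 4n, and U \partial has weight 2d + n <= 4n. The second point is x^n p^2, with
     coefficient twice the leading one of V. *)
  apply: (@even_order_of_symbol F (L4 U V W) M 2 n n 2) => //.
  - by move=> i j /supp[] [-> le_i]; nia.
  - by rewrite coef_L4 coef1.
  - by rewrite coef_L4.
  - by lia.
  - rewrite coef_L4 coefMn -mulr_natr mulf_neq0 //.
    by have := V0; rewrite -lead_coef_eq0 lead_coefE szV.
have U0 : U != 0.
  by apply: contraTneq large => U0; rewrite -def_d U0 size_poly0.
(* The top weight is 4d, attained by U \partial at x^d p; 3n < 2d keeps V \partial^2 and V^2
   strictly below. *)
apply: (@even_order_of_symbol F (L4 U V W) M 3 d d 1) => //.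
- by lia.
- by move=> i j /supp[] [-> le_i]; nia.
- by rewrite coef_L4 coef1.
- by rewrite coef_L4.
- by lia.
(* As n <= d, V' has no term of degree d; the leading coefficient of U remains. *)
- rewrite coef_L4 coefD coefMn coef_deriv nth_default ?mul0rn ?add0r.
  2: by rewrite szV; lia.
  by rewrite -def_d -lead_coefE lead_coef_eq0.
Qed.
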